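(* Let $G$ be a finite abelian group, considered as a finite commutative ring, let $m \ge 1$ be an integer and let $t \ge m$ be an integer. Then $$\mathsf{EGZ}(t,G,m) \ge t+\mathsf{D}(G,m)-m.$$
   Context: A finite abelian group $G\cong \mathbb{Z}_{n_1}\oplus\cdots\oplus\mathbb{Z}_{n_r}$ (with $1<n_1\mid\cdots\mid n_r$) is regarded as a finite commutative ring with coordinate-wise operations. A sequence $S$ over $G$ is a finite sequence of elements of $G$, order disregarded and repetition allowed (i.e. a finite multiset); its length $|S|$ is the number of its elements counted with multiplicity; a subsequence is a sub-multiset. For a positive integer $m$ and a sequence $S=(g_1,\dots,g_\ell)$ over $G$, $$e_m(S)=\sum_{1\le i_1<\cdots<i_m\le \ell}\ \prod_{j=1}^m g_{i_j}\in G$$ (an empty sum is $0$). $\mathsf{D}(G,m)$ denotes the smallest positive integer $z$ such that every sequence $S$ over $G$ of length $|S|\ge z$ contains a subsequence $S'$ of length $|S'|\ge m$ with $e_m(S')=0$. $\mathsf{EGZ}(t,G,m)$ denotes the smallest positive integer $z$ such that every sequence $S$ over $G$ of length $|S|\ge z$ contains a subsequence $S'$ of length exactly $t$ with $e_m(S')=0$; if no such $z$ exists, $\mathsf{EGZ}(t,G,m)=\infty$. *)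

(* Defs.v *)
From HB Require Import structures.
From mathcomp Require Import all_boot all_order all_algebra.
From mathcomp Require Import finmap multiset boolp constructive_ereal.

Set Implicit Arguments.
Unset Strict Implicit.
Unset Printing Implicit Defensive.

Import Order.TTheory GRing.Theory Num.Theory.

Local Open Scope mset_scope.
Local Open Scope ring_scope.

(* The ring Z_(n_1) (+) ... (+) Z_(n_r).  MathComp's 'Z_k is the ring of
   integers mod k only for k > 1, so 1 < n i has to be assumed by users.  For
   r = 0 this is the zero ring, hence only a "pz" (possibly zero) ring. *)
Definition Zsum (r : nat) (n : 'I_r -> nat) : Type :=
  {dffun forall i : 'I_r, 'Z_(n i)}.

Section ZsumRing.
Variables (r : nat) (n : 'I_r -> nat).
Notation G := (Zsum n).
Implicit Types x y : G.

HB.instance Definition _ := Finite.on G.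

Definition Zsum_zero : G := [ffun i => 0].
Definition Zsum_one : G := [ffun i => 1].
Definition Zsum_opp x : G := [ffun i => - x i].
Definition Zsum_add x y : G := [ffun i => x i + y i].
Definition Zsum_mul x y : G := [ffun i => x i * y i].

Fact Zsum_addA : associative Zsum_add.
Proof. by move=> x y z; apply/ffunP=> i; rewrite !ffunE addrA. Qed.
Fact Zsum_addC : commutative Zsum_add.
Proof. by move=> x y; apply/ffunP=> i; rewrite !ffunE addrC. Qed.
Fact Zsum_add0 : left_id Zsum_zero Zsum_add.
Proof. by move=> x; apply/ffunP=> i; rewrite !ffunE add0r. Qed.
Fact Zsum_addN : left_inverse Zsum_zero Zsum_opp Zsum_add.
Proof. by move=> x; apply/ffunP=> i; rewrite !ffunE addNr. Qed.
HB.instance Definition _ :=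
  GRing.isZmodule.Build G Zsum_addA Zsum_addC Zsum_add0 Zsum_addN.

Fact Zsum_mulA : associative Zsum_mul.
Proof. by move=> x y z; apply/ffunP=> i; rewrite !ffunE mulrA. Qed.
Fact Zsum_mulC : commutative Zsum_mul.
Proof. by move=> x y; apply/ffunP=> i; rewrite !ffunE mulrC. Qed.
Fact Zsum_mul1 : left_id Zsum_one Zsum_mul.
Proof. by move=> x; apply/ffunP=> i; rewrite !ffunE mul1r. Qed.
Fact Zsum_mulDl : left_distributive Zsum_mul +%R.
Proof. by move=> x y z; apply/ffunP=> i; rewrite !ffunE mulrDl. Qed.
HB.instance Definition _ :=
  GRing.Zmodule_isComPzRing.Build G Zsum_mulA Zsum_mulC Zsum_mul1 Zsum_mulDl.

End ZsumRing.

(* The m-subsets I of the index set stand for the tuples i_1 < ... < i_m.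
   This is symmetric in the entries of s, so below it is applied to multisets
   through their coercion to seq. *)
Definition elem_sym (R : comPzRingType) (m : nat) (s : seq R) : R :=
  \sum_(I : {set 'I_(size s)} | #|I| == m) \prod_(i in I) tnth (in_tuple s) i.

(* The infimum of a set of natural numbers, +oo if the set is empty. *)
Definition least (P : nat -> Prop) : \bar int :=
  if pselect (exists z, `[< P z >]) is left exP
  then (Posz (ex_minn exP))%:E else +oo%E.

Definition davenport_bound (R : comPzRingType) (m z : nat) : Prop :=
  (0 < z)%N /\
  forall S : {mset R}, (z <= size S)%N ->
    exists T : {mset R},
      [/\ T `<=` S, (m <= size T)%N & elem_sym m T = 0].

Definition davenport (R : comPzRingType) (m : nat) : \bar int :=
  least (davenport_bound R m).

Definition egz_bound (t : nat) (R : comPzRingType) (m z : nat) : Prop :=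
  (0 < z)%N /\
  forall S : {mset R}, (z <= size S)%N ->
    exists T : {mset R},
      [/\ T `<=` S, size T = t & elem_sym m T = 0].

Definition EGZ (t : nat) (R : comPzRingType) (m : nat) : \bar int :=
  least (egz_bound t R m).

(* D(G, m) is a genuine positive integer: a large multiple of m`! copies of a
   single element always has vanishing e_m, since the binomial coefficient
   counting the products is then divisible by #|G|. *)
Lemma elem_sym_nseq (R : comPzRingType) m p (g : R) :
  elem_sym m (nseq p g) = g ^+ m *+ 'C(p, m).
Proof.
rewrite /elem_sym (eq_bigr (fun=> g ^+ m)) => [|I /eqP cI]; last first.
  rewrite -cI -prodr_const; apply: eq_bigr => i _.
  rewrite (tnth_nth g) /= nth_nseq.
  by have := ltn_ord i; rewrite {2}size_nseq => ->.
rewrite sumr_const -[in RHS](size_nseq p g) -[in RHS](card_ord (size _)).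
by rewrite -card_draws; congr (_ *+ _); apply: eq_card => A; rewrite !inE.
Qed.

Lemma davenport_boundP (R : finComPzRingType) m :
  (0 < m)%N -> exists z, davenport_bound R m z.
Proof.
move=> m0; pose p := (m`! * #|R|)%N.
have R0 : (0 < #|R|)%N by apply/card_gt0P; exists 0.
have p0 : (0 < p)%N by rewrite muln_gt0 fact_gt0.
exists (#|R| * p)%N; split; first by rewrite muln_gt0 R0.
move=> S leS.
have [g pg] : exists g, (p <= S g)%N.
  apply/existsP; rewrite -[X in is_true X]negbK negb_exists; apply/negP.
  move/forallP=> lt_p; move: leS; rewrite leqNgt => /negP; apply.
  have -> : size S = \sum_(g : R) S g.
    rewrite (eq_bigr (fun g => count_mem g S)); last first.
      by move=> g _; rewrite count_mem_mset.
    rewrite -sum1_size; under [RHS]eq_bigr do rewrite -sum1_count big_mkcond.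
    rewrite exchange_big; apply: eq_bigr => x _ /=.
    by rewrite (bigD1 x)//= eqxx big1// => y; rewrite eq_sym => /negPf ->.
  rewrite -sum_nat_const.
  rewrite (bigD1 0) //= [ltnRHS](bigD1 0) //= -addSn leq_add //.
    by have := lt_p 0; rewrite -ltnNge.
  by apply: leq_sum => i _; have := lt_p i; rewrite -ltnNge => /ltnW.
exists (msetn p g); split.
- by apply/msubsetP => x; rewrite msetnE; case: eqP => // ->.
- rewrite enum_msetn size_nseq /p.
  apply: (@leq_trans m`!); last by rewrite leq_pmulr.
  by rewrite -(prednK m0) factS leq_pmulr ?fact_gt0.
rewrite enum_msetn elem_sym_nseq.
have /dvdnP[k ->] : (#|R| %| 'C(p, m))%N.
  rewrite -(dvdn_pmul2l (fact_gt0 m)) [(m`! * 'C(_, _))%N]mulnC bin_ffact.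
  by rewrite -(prednK m0) ffactnS (prednK m0) dvdn_mulr.
rewrite mulrnA; set x := _ *+ k.
have : \sum_(y : R) y = \sum_y (x + y) by exact: reindex_inj (addrI x).
by rewrite big_split sumr_const /= -[LHS]add0r => /addIr.
Qed.

Lemma davenport_fin (R : finComPzRingType) m :
  (0 < m)%N -> exists2 d : nat, davenport R m = (Posz d)%:E
    & davenport_bound R m d.
Proof.
move=> m0; rewrite /davenport /least; case: pselect => [exP|[]]; last first.
  by have [z bz] := davenport_boundP R m0; exists z; apply/asboolP.
by case: ex_minnP => d /asboolP bd _; exists d.
Qed.

(* Main.v *)
(* Adjoin t - m zeros to a sequence S.  A subsequence of length t of the padded
   sequence has at least m terms from S, and e_m does not see the zeros; hence
   a bound z for EGZ(t, G, m) gives the bound z + m - t for D(G, m). *)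
Require Import Defs.
From mathcomp Require Import all_boot all_order all_algebra.
From mathcomp Require Import constructive_ereal.
From mathcomp Require Import perm finmap multiset boolp zify.

Import GRing.Theory.

Local Open Scope ring_scope.

(** An [m]-subset of indices not contained in the image of [h] has a zero factor in its product. The
    others are exactly the images of the [m]-subsets for [s1]. *)
Lemma elem_sym_reindex (R : comPzRingType) (m : nat) (s1 s2 : seq R)
    (h : 'I_(size s1) -> 'I_(size s2)) :
  injective h ->
  (forall i : 'I_(size s1), s1`_i = s2`_(h i)) ->
  (forall j : 'I_(size s2), j \notin codom h -> s2`_j = 0) ->
  elem_sym m s1 = elem_sym m s2.
Proof.
move=> h_inj s12 s2_0; rewrite /elem_sym.
rewrite [RHS](bigID (fun I : {set _} => I \subset codom h)) /=.
rewrite [X in _ = _ + X]big1 ?addr0 => [|I /andP[_ /subsetPn[j jI jh]]]; last first.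
  by rewrite (bigD1 j) //= (tnth_nth 0) s2_0 ?mul0r.
(* Direct image under [h] is inverted by preimage on the subsets of [codom h]. *)
rewrite (reindex_onto (fun A : {set 'I_(size s1)} => h @: A)
                      (fun B => h @^-1: B)) => [|I /andP[_ Ih]] /=; last first.
  apply/setP => j; apply/imsetP/idP => [[i + ->]|jI]; first by rewrite inE.
  have /codomP[i ji] := subsetP Ih j jI; exists i => //.
  by rewrite inE -ji.
apply: eq_big => [A|A _].
  rewrite card_imset //.
  have -> : h @: A \subset codom h.
    by apply/subsetP => _ /imsetP[i _ ->]; apply: codom_f.
  have -> : h @^-1: (h @: A) = A by apply/setP => i; rewrite inE mem_imset.
  by rewrite eqxx !andbT.
rewrite big_imset; last by move=> i j _ _; apply: h_inj.
by apply: eq_bigr => i _; rewrite !(tnth_nth 0) /= s12.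
Qed.

(** Reordering and zero padding are treated together because the coercion from multisets to
    sequences fixes no convenient order of the entries. *)
Lemma elem_sym_perm_nseq0 (R : comPzRingType) (m k : nat) (s1 s2 : seq R) :
  perm_eq s2 (s1 ++ nseq k 0) -> elem_sym m s1 = elem_sym m s2.
Proof.
move=> perm12; have := perm_size perm12; rewrite size_cat size_nseq => size12.
have le12 : (size s1 <= size s2)%N by rewrite size12 leq_addr.
move: perm12; rewrite perm_sym => /(@tuple_permP _ _ _ (in_tuple s2))[p s1E].
have nth_p (i : 'I_(size s2)) : (s1 ++ nseq k 0)`_i = s2`_(p i).
  rewrite s1E (nth_map i) ?size_enum_ord // nth_ord_enum.
  by rewrite (tnth_nth 0).
(* The first [size s1] positions of the padded sequence, followed through [p]; every index of [s2]
   missed by [h] comes from the block of zeros. *)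
pose h i := p (widen_ord le12 i).
apply: (@elem_sym_reindex R m s1 s2 h) => [i j /perm_inj /(congr1 val) ij|i|j].
- exact: val_inj.
- by rewrite -nth_p nth_cat /= ltn_ord.
rewrite -[j](permKV p) -nth_p nth_cat nth_nseq.
set i := (p^-1)%g j => i_codom; case: ltnP => [i_lt|_]; last by case: ifP.
by case/negP: i_codom; apply/codomP; exists (Ordinal i_lt); congr (p _); apply: val_inj.
Qed.

Local Open Scope mset_scope.

Lemma davenport_bound_egz (R : comPzRingType) (m t z : nat) :
  (0 < m)%N -> (m <= t)%N -> egz_bound t R m z ->
  davenport_bound R m (z + m - t).
Proof.
move=> m0 mt [_ egz].
(* Stated separately since it serves twice: as the bound itself, and on [mset0] to get
   positivity. *)
have sub_ex (S : {mset R}) : (z + m - t <= size S)%N ->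
    exists T : {mset R}, [/\ T `<=` S, (m <= size T)%N & elem_sym m T = 0].
  move=> leS; pose Z : {mset R} := msetn (t - m)%N 0.
  have sizeSZ : size (S `+` Z) = (size S + (t - m))%N.
    rewrite -(size_nseq (t - m) (0 : R)) -size_cat; apply: perm_size.
    apply/allP => x _ /=.
    rewrite count_cat !count_mem_mset msetE2 msetnE count_nseq /= [0 == x]eq_sym.
    by case: ifP; rewrite ?mul1n ?mul0n.
  have [|T [TSZ sizeT T0]] := egz (S `+` Z); first by lia.
  (* Removing [Z] from [T] deletes at most [t - m] zeros, and fewer if [T] does not contain that
     many. *)
  have permT : perm_eq T ((T `\` Z) ++ nseq (minn (T 0%R) (t - m)) 0).
    apply/allP => x _ /=; rewrite count_cat !count_mem_mset msetE2 msetnE.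
    rewrite count_nseq /= [0 == x]eq_sym.
    by case: (x =P 0) => [->|_]; rewrite ?mul1n ?mul0n; apply/eqP; lia.
  have sizeTZ : size T = (size (T `\` Z) + minn (T 0%R) (t - m))%N.
    by rewrite (perm_size permT) size_cat size_nseq.
  exists (T `\` Z); split; last by rewrite (elem_sym_perm_nseq0 _ m _ _ _ permT).
  - apply/msubsetP => x; have /msubsetP/(_ x) := TSZ.
    by rewrite msetE2 msetE2; lia.
  (* At most [t - m] of the [t] terms were deleted, so at least [m] remain. *)
  - by lia.
(* If the truncated difference [z + m - t] were 0, the empty multiset would have a subsequence of
   length at least [m > 0]. *)
split=> //; rewrite lt0n; apply/eqP => z_eq.
have [|T [/msubsetP T0 leT _]] := sub_ex mset0; first by rewrite z_eq.
have T_eq0 : T = mset0.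
  by apply/msetP => x; have := T0 x; rewrite mset0E; lia.
by move: leT; rewrite T_eq0 size_mset0; lia.
Qed.

Lemma least_le (P : nat -> Prop) (z : nat) :
  P z -> (least P <= (Posz z)%:E)%E.
Proof.
move=> Pz; rewrite /least; case: pselect => [exP|[]]; last by exists z; apply/asboolP.
by case: ex_minnP => y _ /(_ z); rewrite lee_fin; apply; apply/asboolP.
Qed.

Theorem theorem2p1 (r : nat) (n : 'I_r -> nat)
    (n_gt1 : forall i : 'I_r, (1 < n i)%N)
    (n_dvd : forall i j : 'I_r, (i <= j)%N -> (n i %| n j)%N)
    (m t : nat) (m_ge1 : (1 <= m)%N) (t_ge_m : (m <= t)%N) :
  (EGZ t (Zsum n) m >= (Posz t)%:E + davenport (Zsum n) m - (Posz m)%:E)%E.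
Proof.
have [d dE [d0 _]] := davenport_fin (Zsum n) m_ge1.
rewrite dE {1}/EGZ /least; case: pselect => [exz|_]; last exact: leey.
case: ex_minnP => z /asboolP /(davenport_bound_egz _ _ _ _ m_ge1 t_ge_m) /least_le + _.
(* The subtraction in [d <= z + m - t] is truncated; [0 < d] excludes the truncated case, so
   [t + d - m <= z] holds over the integers. *)
by rewrite -/(davenport _ _) dE -EFinD !lee_fin; lia.
Qed.
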